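(* (Cosheaf version of Dowker duality) $Dual$ is a functor $\mathbf{CoShvAsc}\to\mathbf{CoShvAsc}$ that makes the following diagram of functors commute: $$Dual\circ CoShvRep = CoShvRep\circ Transp:\ \mathbf{Rel}\to\mathbf{CoShvAsc},$$ where, for a relation $(X,Y,R)$, each vertex of the space of global cosections of $CoShvRep(X,Y,R)$ (an equivalence class of copies of a single $y\in Y$) is identified with that element $y$.
   Context: The category $\mathbf{Rel}$ has as objects triples $(X,Y,R)$ where $X,Y$ are sets and $R\subseteq X\times Y$. A morphism $(X,Y,R)\to(X',Y',R')$ is a pair of functions $f:X\to X'$, $g:Y\to Y'$ such that $(f(x),g(y))\in R'$ whenever $(x,y)\in R$; composition is componentwise. The functor $Transp:\mathbf{Rel}\to\mathbf{Rel}$ sends $(X,Y,R)$ to $(Y,X,R^T)$ with $R^T=\{(y,x):(x,y)\in R\}$, and sends $(f,g)$ to $(g,f)$. Abstract simplicial complexes are here collections of nonempty finite sets (simplices) closed under passing to nonempty subsets; the vertices are the elements $v$ with $\{v\}$ a simplex. A simplicial map is a function on vertices sending simplices to simplices. The Dowker complex $D(X,Y,R)$ consists of the nonempty finite $\sigma\subseteq X$ for which there is a $y\in Y$ with $(x,y)\in R$ for all $x\in\sigma$. For such $\sigma$, $Y_\sigma=\{y\in Y:(x,y)\in R\ \forall x\in\sigma\}$. Also $R|_{A,B}=R\cap(A\times B)$. Objects of $\mathbf{CoShvAsc}$: a cosheaf $\mathfrak{C}$ of abstract simplicial complexes on an abstract simplicial complex $K$ assigns to each simplex $\alpha$ of $K$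 an abstract simplicial complex $\mathfrak{C}(\alpha)$ (costalk) and to each $\alpha\subseteq\beta$ a simplicial map $\mathfrak{C}(\alpha\subseteq\beta):\mathfrak{C}(\beta)\to\mathfrak{C}(\alpha)$ (extension) whose vertex function is an inclusion, contravariantly functorial on the face poset of $K$. Morphisms $m:\mathfrak{C}\to\mathfrak{D}$ ($\mathfrak{C}$ on $K$, $\mathfrak{D}$ on $L$) along a simplicial base map $f:K\to L$: simplicial maps $m_\alpha:\mathfrak{C}(\alpha)\to\mathfrak{D}(f(\alpha))$ with $\mathfrak{D}(f(\alpha)\subseteq f(\beta))\circ m_\beta=m_\alpha\circ\mathfrak{C}(\alpha\subseteq\beta)$. Composition is composition of base maps and components. The space of global cosections $\mathfrak{C}(K)$ is the abstract simplicial complex whose vertices are the classes of the disjoint union of the vertex sets of all costalks under the equivalence relation generated by $c\sim\mathfrak{C}(\alpha\subseteq\beta)(c)$ (for $\alpha\subseteq\beta$ and $c$ a vertex of $\mathfrak{C}(\beta)$), and whose simplices are the images of simplices of costalks. For a simplex $\sigma$ of $\mathfrak{C}(K)$, write ''$\sigma\in\mathfrak{C}(\alpha)$'' if $\sigma$ is the image of a simplex of $\mathfrak{C}(\alpha)$. A morphism $m$ induces a simplicial map $m_*:\mathfrak{C}(K)\to\mathfrak{D}(L)$ by $[c]\mapsto[m_\alpha(c)]$ for $c$ a vertex of $\mathfrak{C}(\alpha)$. $Dual(\mathfrak{C})$ is the cosheaf on the complex $\mathfrak{C}(K)$ whose costalk at $\sigma$ is the subcomplex $\bigcup\{\alpha\in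 K:\sigma\in\mathfrak{C}(\alpha)\}$ of $K$, i.e. the complex formed by all simplices $\alpha$ of $K$ with $\sigma\in\mathfrak{C}(\alpha)$, and whose extensions are inclusions. For a morphism $m:\mathfrak{C}\to\mathfrak{D}$ along $f$, $Dual(m)$ has base map $m_*$ and component at $\sigma$ the restriction of $f$ to $(Dual(\mathfrak{C}))(\sigma)$. The functor $CoShvRep:\mathbf{Rel}\to\mathbf{CoShvAsc}$ sends $(X,Y,R)$ to the cosheaf $\mathfrak{R}$ on $D(X,Y,R)$ with costalks $\mathfrak{R}(\sigma)=D(Y_\sigma,\sigma,(R|_{\sigma,Y_\sigma})^T)$ and extensions along $\sigma\subseteq\tau$ induced by the inclusions $Y_\tau\hookrightarrow Y_\sigma$. It sends $(f,g)$ to the morphism with base map having vertex function $f$ and component at $\sigma$ having vertex function $g|_{Y_\sigma}$. *)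

(* Defs.v *)
From mathcomp Require Import all_boot.
From mathcomp Require Import boolp classical_sets cardinality.
From Stdlib Require Import Relation_Operators.

Set Implicit Arguments.
Unset Strict Implicit.
Unset Printing Implicit Defensive.

Local Open Scope classical_set_scope.

Record category := Category {
  obj :> Type;
  hom : obj -> obj -> Type;
  idm : forall x, hom x x;
  comp : forall x y z, hom y z -> hom x y -> hom x z;
  comp_idl : forall x y (f : hom x y), comp (idm y) f = f;
  comp_idr : forall x y (f : hom x y), comp f (idm x) = f;
  comp_assoc : forall w x y z (h : hom y z) (g : hom x y) (f : hom w x),
    comp h (comp g f) = comp (comp h g) f
}.

Definition is_functor (C D : category) (F0 : C -> D)
    (F1 : forall x y, hom x y -> hom (F0 x) (F0 y)) : Prop :=
  (forall x, F1 x x (idm x) = idm (F0 x)) /\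
  (forall x y z (g : hom y z) (f : hom x y),
     F1 x z (comp g f) = comp (F1 y z g) (F1 x y f)).

Record functor (C D : category) := Functor {
  fobj :> C -> D;
  fmor : forall x y, hom x y -> hom (fobj x) (fobj y);
  functorP : is_functor fmor
}.

Lemma functor_comp_subproof (C D E : category) (G : functor D E)
    (F : functor C D) :
  is_functor (fun x y (f : hom x y) => fmor G (fmor F f)).
Proof.
case: (functorP G) => G1 Gc; case: (functorP F) => F1 Fc.
by split=> [x|x y z g f]; rewrite ?F1 ?G1 // Fc Gc.
Qed.

Definition functor_comp (C D E : category) (G : functor D E)
  (F : functor C D) : functor C E := Functor (functor_comp_subproof G F).

Definition is_natural (C D : category) (F G : functor C D)
    (eta : forall x, hom (F x) (G x)) : Prop :=
  forall x y (f : hom x y), comp (eta y) (fmor F f) = comp (fmor G f) (eta x).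

Definition is_iso (C : category) (x y : C) (f : hom x y) : Prop :=
  exists g : hom y x, comp g f = idm x /\ comp f g = idm y.

(* A complex has an ambient type [V], not all of whose elements need be
   vertices: sharing ambient types gives a literal meaning to inclusions and
   unions of complexes. *)
Record asc (V : Type) := Asc {
  simplices :> set (set V);
  simplex_finite : forall s, simplices s -> finite_set s;
  simplex_nonempty : forall s, simplices s -> s !=set0;
  simplex_sub : forall s t, simplices t -> s `<=` t -> s !=set0 -> simplices s
}.

Definition is_simplex V (K : asc V) : set V -> Prop := simplices K.
Coercion is_simplex : asc >-> Funclass.

Lemma asc_ext V (K L : asc V) : (forall s, K s <-> L s) -> K = L.
Proof.
case: K L => [K K1 K2 K3] [L L1 L2 L3] /= KL.
have E : K = L by apply/funext => s; apply/propext.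
subst L; congr Asc; exact: Prop_irrelevance.
Qed.

Definition vertices V (K : asc V) : set V := [set v | K [set v]].

Definition vertex_image V W (A : set V) (B : set W) (f : A -> B) (s : set V) :
  set W := [set val (f v) | v in [set v : A | s (val v)]].

Record smap V W (K : asc V) (L : asc W) := Smap {
  vfun :> vertices K -> vertices L;
  smapP : forall s, K s -> L (vertex_image vfun s)
}.

Definition simplex_map V W (K : asc V) (L : asc W) (f : smap K L)
    (s : simplices K) : simplices L :=
  SigSub (mem_set (smapP f (set_valP s))).

Lemma smap_ext V W (K : asc V) (L : asc W) (f g : smap K L) :
  (forall v, val (f v) = val (g v)) -> f = g.
Proof.
case: f g => [f fP] [g gP] /= fg.
have E : f = g by apply/funext => v; apply/val_inj/fg.
subst g; congr Smap; exact: Prop_irrelevance.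
Qed.

Lemma vertex_of_simplex V (K : asc V) s v : K s -> s v -> vertices K v.
Proof. by move=> Ks sv; apply: (simplex_sub Ks) => [_ ->//|]; exists v. Qed.

Section SmapConstructions.
Variables (U V W : Type) (H : asc U) (K : asc V) (L : asc W).

Lemma smap_comp_subproof (g : smap K L) (f : smap H K) s :
  H s -> L (vertex_image (fun v => g (f v)) s).
Proof.
move=> Hs; have /(smapP g) := smapP f Hs; congr (L _); apply/seteqP; split.
- move=> _ [v /= [u su uv] <-]; exists u => //=.
  by congr (val (g _)); apply: val_inj.
- by move=> _ [u /= su <-]; exists (f u) => //=; exists u.
Qed.

Definition smap_comp (g : smap K L) (f : smap H K) : smap H L :=
  Smap (smap_comp_subproof g f).

Variables (f : V -> W) (fP : forall s, K s -> L (f @` s)).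

Lemma smap_of_vertex (v : vertices K) : f (val v) \in vertices L.
Proof.
by apply: mem_set; rewrite /vertices /= -image_set1; apply/fP/(set_valP v).
Qed.

Lemma smap_of_subproof s :
  K s ->
  L (vertex_image (fun v : vertices K => SigSub (smap_of_vertex v)) s).
Proof.
move=> Ks; have := fP Ks; congr (L _); apply/seteqP; split.
- move=> _ [v sv <-].
  by exists (SigSub (mem_set (vertex_of_simplex Ks sv))).
- by move=> _ [v /= sv <-]; exists (val v).
Qed.

Definition smap_of : smap K L := Smap smap_of_subproof.

End SmapConstructions.

Lemma smap_incl_subproof V (K L : asc V) (KL : K `<=` L) s :
  K s -> L (id @` s).
Proof. by rewrite image_id; apply: KL. Qed.

Definition smap_incl V (K L : asc V) (KL : K `<=` L) : smap K L :=
  smap_of (smap_incl_subproof KL).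

Lemma subset_incl V (K : asc V) : K `<=` K.
Proof. by []. Qed.

Definition smap_id V (K : asc V) : smap K K := smap_incl (@subset_incl V K).

Lemma simplex_map_mono V W (K : asc V) (L : asc W) (f : smap K L)
    (a b : simplices K) :
  val a `<=` val b -> val (simplex_map f a) `<=` val (simplex_map f b).
Proof. by move=> ab _ [v /= av <-]; exists v => //=; apply: ab. Qed.

Arguments simplex_map_mono {V W K L} f {a b} ab.

Lemma simplex_map_id V (K : asc V) (a : simplices K) :
  val (simplex_map (smap_id K) a) = val a.
Proof.
apply/seteqP; split=> [_ [v av <-]//|v av].
by exists (SigSub (mem_set (vertex_of_simplex (set_valP a) av))).
Qed.

Lemma simplex_map_comp U V W (H : asc U) (K : asc V) (L : asc W)
    (g : smap K L) (f : smap H K) (a : simplices H) :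
  val (simplex_map (smap_comp g f) a) =
  val (simplex_map g (simplex_map f a)).
Proof.
apply/seteqP; split.
- by move=> _ [u /= su <-]; exists (f u) => //=; exists u.
- move=> _ [v /= [u su uv] <-]; exists u => //=.
  by congr (val (g _)); apply: val_inj.
Qed.

(* All costalks share the ambient type [stalk_type], so [extension_incl] says
   literally that extensions are inclusions on vertices. *)
Record cosheaf := Cosheaf {
  base_type : Type;
  base : asc base_type;
  stalk_type : Type;
  costalk : simplices base -> asc stalk_type;
  extension : forall a b : simplices base, val a `<=` val b ->
    smap (costalk b) (costalk a);
  extension_incl : forall (a b : simplices base) (ab : val a `<=` val b)
    (c : vertices (costalk b)), val (extension ab c) = val c;
  extension_id : forall (a : simplices base) (aa : val a `<=` val a),
    extension aa = smap_id (costalk a);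
  extension_comp : forall (a b c : simplices base) (ab : val a `<=` val b)
    (bc : val b `<=` val c) (ac : val a `<=` val c),
    extension ac = smap_comp (extension ab) (extension bc)
}.

Record cosheaf_hom (C D : cosheaf) := CosheafHom {
  base_map : smap (base C) (base D);
  component : forall a : simplices (base C),
    smap (costalk a) (costalk (simplex_map base_map a));
  component_natural : forall (a b : simplices (base C))
      (ab : val a `<=` val b),
    smap_comp (extension (simplex_map_mono base_map ab)) (component b) =
    smap_comp (component a) (extension ab)
}.

Lemma cosheaf_hom_ext C D (m n : cosheaf_hom C D) :
  (forall v, val (base_map m v) = val (base_map n v)) ->
  (forall a c, val (component m a c) = val (component n a c)) -> m = n.
Proof.
case: m n => [f m mP] [g n nP] /= /smap_ext fg.
subst g => mn; have E : m = n.
  by apply: functional_extensionality_dep => a; apply/smap_ext/mn.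
subst n; congr CosheafHom; exact: Prop_irrelevance.
Qed.

Section CosheafCategory.

(* The images of a simplex under [g \o f] and successively under [f] and [g]
   are equal but not convertible sets (similarly for the identity).  The
   extension along this equality, which is the identity, serves as a cast. *)
Lemma cosheaf_id_cast C (a : simplices (base C)) :
  val (simplex_map (smap_id (base C)) a) `<=` val a.
Proof. by rewrite simplex_map_id. Qed.

Lemma cosheaf_id_natural C (a b : simplices (base C)) (ab : val a `<=` val b) :
  smap_comp (extension (simplex_map_mono (smap_id (base C)) ab))
    (extension (@cosheaf_id_cast C b)) =
  smap_comp (extension (@cosheaf_id_cast C a)) (extension ab).
Proof. by apply: smap_ext => c /=; rewrite !extension_incl. Qed.

Definition cosheaf_id C : cosheaf_hom C C :=
  CosheafHom (@cosheaf_id_natural C).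

Variables (C D E : cosheaf) (n : cosheaf_hom D E) (m : cosheaf_hom C D).

Lemma cosheaf_comp_cast (a : simplices (base C)) :
  val (simplex_map (smap_comp (base_map n) (base_map m)) a) `<=`
  val (simplex_map (base_map n) (simplex_map (base_map m) a)).
Proof. by rewrite simplex_map_comp. Qed.

Definition cosheaf_comp_component (a : simplices (base C)) :=
  smap_comp (extension (@cosheaf_comp_cast a))
    (smap_comp (component n (simplex_map (base_map m) a)) (component m a)).

Lemma component_naturalE C' D' (m' : cosheaf_hom C' D')
    (a b : simplices (base C')) (ab : val a `<=` val b)
    (c : vertices (costalk b)) :
  val (component m' a (extension ab c)) = val (component m' b c).
Proof.
have /(congr1 (fun h : smap _ _ => val (h c))) /= := component_natural m' ab.
by rewrite extension_incl.
Qed.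

Lemma cosheaf_comp_natural (a b : simplices (base C)) (ab : val a `<=` val b) :
  smap_comp (extension (simplex_map_mono
    (smap_comp (base_map n) (base_map m)) ab)) (cosheaf_comp_component b) =
  smap_comp (cosheaf_comp_component a) (extension ab).
Proof.
apply: smap_ext => c /=; rewrite !extension_incl.
have := component_naturalE n (simplex_map_mono (base_map m) ab)
  (component m b c).
move=> <-; congr (val (component n _ _)); apply: val_inj.
by rewrite extension_incl component_naturalE.
Qed.

Definition cosheaf_comp : cosheaf_hom C E := CosheafHom cosheaf_comp_natural.

End CosheafCategory.

Lemma cosheaf_comp_idl C D (m : cosheaf_hom C D) :
  cosheaf_comp (cosheaf_id D) m = m.
Proof. by apply: cosheaf_hom_ext => //= a c; rewrite !extension_incl. Qed.

Lemma component_val C D (m : cosheaf_hom C D) (a b : simplices (base C))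
    (c : vertices (costalk a)) (d : vertices (costalk b)) :
  val a = val b -> val c = val d ->
  val (component m a c) = val (component m b d).
Proof. by move/val_inj => ab; subst b => /val_inj ->. Qed.

Lemma cosheaf_comp_idr C D (m : cosheaf_hom C D) :
  cosheaf_comp m (cosheaf_id C) = m.
Proof.
apply: cosheaf_hom_ext => [v|a c] /=.
  by congr (val (base_map m _)); apply: val_inj.
rewrite !extension_incl; apply: component_val; first exact: simplex_map_id.
by rewrite extension_incl.
Qed.

Lemma cosheaf_comp_assoc B C D E (h : cosheaf_hom D E) (g : cosheaf_hom C D)
    (f : cosheaf_hom B C) :
  cosheaf_comp h (cosheaf_comp g f) = cosheaf_comp (cosheaf_comp h g) f.
Proof.
apply: cosheaf_hom_ext => //= a c; rewrite !extension_incl.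
by apply: component_val; rewrite ?simplex_map_comp //= extension_incl.
Qed.

Definition CoShvAsc : category := {|
  obj := cosheaf;
  hom := cosheaf_hom;
  idm := cosheaf_id;
  comp := cosheaf_comp;
  comp_idl := cosheaf_comp_idl;
  comp_idr := cosheaf_comp_idr;
  comp_assoc := cosheaf_comp_assoc
|}.

Section Cosections.
Variable C : cosheaf.

Definition costalk_vertex := {a : simplices (base C) & vertices (costalk a)}.

Definition extends (p q : costalk_vertex) : Prop :=
  exists (a b : simplices (base C)) (ab : val a `<=` val b)
    (c : vertices (costalk b)),
    p = existT _ b c /\ q = existT _ a (extension ab c).

Definition same_cosection : costalk_vertex -> costalk_vertex -> Prop :=
  clos_refl_sym_trans costalk_vertex extends.

Definition class (p : costalk_vertex) : set costalk_vertex :=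
  [set q | same_cosection p q].

Definition class_image (a : simplices (base C)) (s : set (stalk_type C)) :
    set (set costalk_vertex) :=
  [set class (existT _ a c) | c in [set c : vertices (costalk a) | s (val c)]].

Definition cosection_simplices : set (set (set costalk_vertex)) :=
  [set S | exists (a : simplices (base C)) (s : set (stalk_type C)),
     costalk a s /\ S = class_image a s].

Lemma cosection_finite S : cosection_simplices S -> finite_set S.
Proof.
move=> [a [s [as_ ->]]]; apply/finite_image/finite_preimage.
  by move=> x y _ _ /val_inj.
exact: simplex_finite as_.
Qed.

Lemma cosection_nonempty S : cosection_simplices S -> S !=set0.
Proof.
move=> [a [s [as_ ->]]]; have [v sv] := simplex_nonempty as_.
exists (class (existT _ a (SigSub (mem_set (vertex_of_simplex as_ sv))))).
by exists (SigSub (mem_set (vertex_of_simplex as_ sv))).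
Qed.

Lemma cosection_sub S T :
  cosection_simplices T -> S `<=` T -> S !=set0 -> cosection_simplices S.
Proof.
move=> [a [t [at_ ->]]] ST [k Sk].
pose s := [set val c | c in
  [set c : vertices (costalk a) | t (val c) /\ S (class (existT _ a c))]].
exists a, s; split.
  apply: (simplex_sub at_) => [_ [c /= [tc _] <-]//|].
  have [c tc kc] := ST _ Sk; exists (val c), c => //=; split=> //.
  by rewrite kc.
apply/seteqP; split=> [l Sl|].
  have [c tc lc] := ST _ Sl; exists c => //=; exists c => //=; split=> //.
  by rewrite lc.
by move=> _ [c [d [td Sd] /val_inj dc] <-]; rewrite -dc.
Qed.

Definition cosections : asc (set costalk_vertex) :=
  Asc cosection_finite cosection_nonempty cosection_sub.

Lemma class_vertex (p : costalk_vertex) : class p \in vertices cosections.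
Proof.
apply: mem_set; case: p => a c; exists a, [set val c].
split; first exact: (set_valP c).
apply/seteqP; split=> [_ ->|_ [d /= /val_inj -> <-]//]; by exists c.
Qed.

Definition class_of (p : costalk_vertex) : vertices cosections :=
  SigSub (class_vertex p).

Definition in_costalk (S : simplices cosections) (a : simplices (base C)) :
  Prop := exists s : set (stalk_type C), costalk a s /\ val S = class_image a s.

Lemma class_eq p q : same_cosection p q -> class p = class q.
Proof.
move=> pq; apply/seteqP; split=> r /=.
  by apply: rst_trans; apply: rst_sym.
exact: rst_trans.
Qed.

Lemma class_extension (a b : simplices (base C)) (ab : val a `<=` val b)
    (c : vertices (costalk b)) :
  class (existT _ a (extension ab c)) = class (existT _ b c).
Proof.
by apply: class_eq; apply: rst_sym; apply: rst_step; exists a, b, ab, c.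
Qed.

Lemma in_costalk_mono (S : simplices cosections) (a b : simplices (base C)) :
  val a `<=` val b -> in_costalk S b -> in_costalk S a.
Proof.
move=> ab [s [bs SE]]; exists (vertex_image (extension ab) s).
split; first exact: smapP.
rewrite SE; apply/seteqP; split=> [_ [c sc <-]|].
  by exists (extension ab c); rewrite /= ?class_extension //; exists c.
by move=> _ [d [c sc /val_inj <-] <-]; exists c => //; rewrite class_extension.
Qed.

Lemma in_costalk_sub (S T : simplices cosections) (a : simplices (base C)) :
  val S `<=` val T -> in_costalk T a -> in_costalk S a.
Proof.
move=> ST [t [at_ TE]].
have Sne := simplex_nonempty (set_valP S).
pose s := [set val c | c in
  [set c : vertices (costalk a) | t (val c) /\ val S (class (existT _ a c))]].
exists s; split.
  apply: (simplex_sub at_) => [_ [c /= [tc _] <-]//|].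
  have [k Sk] := Sne; have := ST _ Sk; rewrite TE => -[c tc kc].
  by exists (val c), c => //=; split=> //; rewrite kc.
apply/seteqP; split=> [l Sl|].
  have := ST _ Sl; rewrite TE => -[c tc lc].
  by exists c => //=; exists c => //=; split=> //; rewrite lc.
by move=> _ [c [d [td Sd] /val_inj dc] <-]; rewrite -dc.
Qed.

End Cosections.

Section CosectionMap.
Variables (C D : cosheaf) (m : cosheaf_hom C D).

Definition costalk_vertex_map (p : costalk_vertex C) : costalk_vertex D :=
  existT _ (simplex_map (base_map m) (projT1 p)) (component m _ (projT2 p)).

(* Maps the class of [p] to the class of its image: see [class_mapE]. *)
Definition class_map (S : set (costalk_vertex C)) : set (costalk_vertex D) :=
  \bigcup_(p in S) class (costalk_vertex_map p).

Lemma same_cosection_map p q :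
  same_cosection p q ->
  same_cosection (costalk_vertex_map p) (costalk_vertex_map q).
Proof.
elim=> {p q} [p q|p|p q _ IH|p q r _ IH1 _ IH2].
- move=> [a [b [ab [c [-> ->]]]]]; apply: rst_step.
  exists (simplex_map (base_map m) a), (simplex_map (base_map m) b).
  exists (simplex_map_mono (base_map m) ab), (component m b c).
  split=> //; rewrite /costalk_vertex_map /=; congr existT.
  by apply: val_inj; rewrite extension_incl component_naturalE.
- exact: rst_refl.
- exact: rst_sym.
- exact: rst_trans IH2.
Qed.

Lemma class_mapE p : class_map (class p) = class (costalk_vertex_map p).
Proof.
apply/seteqP; split=> [r [q pq qr]|r pr].
  exact: rst_trans (same_cosection_map pq) qr.
by exists p => //; apply: rst_refl.
Qed.

Lemma class_map_image (a : simplices (base C)) s : costalk a s ->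
  class_map @` class_image a s =
  class_image (simplex_map (base_map m) a) (vertex_image (component m a) s).
Proof.
move=> as_; apply/seteqP; split.
- move=> _ [_ [c sc <-] <-]; rewrite class_mapE.
  by exists (component m a c) => //=; exists c.
- move=> _ [d [c sc /val_inj <-] <-].
  by exists (class (existT _ a c)); rewrite ?class_mapE //; exists c.
Qed.

Lemma class_map_simplicial S : cosections C S -> cosections D (class_map @` S).
Proof.
move=> [a [s [as_ ->]]]; rewrite class_map_image //.
exists (simplex_map (base_map m) a), (vertex_image (component m a) s).
by split=> //; apply: smapP.
Qed.

Definition cosection_map : smap (cosections C) (cosections D) :=
  smap_of class_map_simplicial.

Lemma cosection_map_class p :
  cosection_map (class_of p) = class_of (costalk_vertex_map p).
Proof. by apply: val_inj; rewrite /= class_mapE. Qed.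

End CosectionMap.

Section Dual.
Variable C : cosheaf.

Definition dual_simplices (S : simplices (cosections C)) :
    set (set (base_type C)) :=
  [set val a | a in [set a : simplices (base C) | in_costalk S a]].

Lemma dual_finite S s : dual_simplices S s -> finite_set s.
Proof. by move=> [a _ <-]; apply: simplex_finite (set_valP a). Qed.

Lemma dual_nonempty S s : dual_simplices S s -> s !=set0.
Proof. by move=> [a _ <-]; apply: simplex_nonempty (set_valP a). Qed.

Lemma dual_sub S s t :
  dual_simplices S t -> s `<=` t -> s !=set0 -> dual_simplices S s.
Proof.
move=> [b bS <-] sb s0.
exists (SigSub (mem_set (simplex_sub (set_valP b) sb s0))) => //=.
exact: in_costalk_mono bS.
Qed.

Definition dual_costalk (S : simplices (cosections C)) : asc (base_type C) :=
  Asc (@dual_finite S) (@dual_nonempty S) (@dual_sub S).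

Lemma dual_costalk_mono (S T : simplices (cosections C)) :
  val S `<=` val T -> dual_costalk T `<=` dual_costalk S.
Proof.
by move=> ST _ [a Ta <-]; exists a => //; apply: in_costalk_sub Ta.
Qed.

Definition dual_extension (S T : simplices (cosections C))
    (ST : val S `<=` val T) : smap (dual_costalk T) (dual_costalk S) :=
  smap_incl (dual_costalk_mono ST).

Lemma dual_extension_incl S T (ST : val S `<=` val T)
    (v : vertices (dual_costalk T)) : val (dual_extension ST v) = val v.
Proof. by []. Qed.

Lemma dual_extension_id S (SS : val S `<=` val S) :
  dual_extension SS = smap_id (dual_costalk S).
Proof. exact: smap_ext. Qed.

Lemma dual_extension_comp S T U (ST : val S `<=` val T) (TU : val T `<=` val U)
    (SU : val S `<=` val U) :
  dual_extension SU = smap_comp (dual_extension ST) (dual_extension TU).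
Proof. exact: smap_ext. Qed.

Definition dual_obj : cosheaf :=
  Cosheaf dual_extension_incl dual_extension_id dual_extension_comp.

Lemma dual_costalk_base S : dual_costalk S `<=` base C.
Proof. by move=> _ [a _ <-]; apply: set_valP. Qed.

End Dual.

Section DualMap.
Variables (C D : cosheaf) (m : cosheaf_hom C D).

Definition dual_vertex (S : simplices (cosections C))
    (v : vertices (dual_costalk S)) : vertices (base D) :=
  base_map m (smap_incl (@dual_costalk_base C S) v).

Lemma dual_component_simplicial (S : simplices (cosections C)) s :
  dual_costalk S s ->
  dual_costalk (simplex_map (cosection_map m) S)
    (vertex_image (@dual_vertex S) s).
Proof.
move=> Ss; have [a aS aE] := Ss.
exists (simplex_map (base_map m) a); last first.
  rewrite /= aE; apply/seteqP; split.
    move=> _ [v sv <-].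
    exists (SigSub (mem_set (vertex_of_simplex Ss sv))) => //=.
    by congr (val (base_map m _)); apply: val_inj.
  by move=> _ [v sv <-]; exists (smap_incl (@dual_costalk_base C S) v).
have [t [at_ SE]] := aS; exists (vertex_image (component m a) t).
split; first exact: smapP.
rewrite -class_map_image // -SE /=; apply/seteqP; split.
  by move=> _ [k Sk <-]; exists (val k).
move=> _ [k Sk <-].
by exists (SigSub (mem_set (vertex_of_simplex (set_valP S) Sk))).
Qed.

Lemma dual_component_vertex (S : simplices (cosections C))
    (v : vertices (dual_costalk S)) :
  val (dual_vertex v) \in
    vertices (dual_costalk (simplex_map (cosection_map m) S)).
Proof.
apply: mem_set; rewrite /vertices /=.
have := dual_component_simplicial (set_valP v); congr (dual_costalk _ _).
apply/seteqP; split=> [_ [w /= /val_inj -> <-]//|_ ->]; by exists v.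
Qed.

Definition dual_component (S : simplices (cosections C)) :
    smap (dual_costalk S) (dual_costalk (simplex_map (cosection_map m) S)) :=
  Smap (vfun := fun v => SigSub (dual_component_vertex v))
    (@dual_component_simplicial S).

Lemma dual_component_natural (S T : simplices (base (dual_obj C)))
    (ST : val S `<=` val T) :
  smap_comp
    (@extension (dual_obj D) _ _ (simplex_map_mono (cosection_map m) ST))
    (dual_component T) =
  smap_comp (dual_component S) (@extension (dual_obj C) _ _ ST).
Proof.
apply: smap_ext => v /=; rewrite /dual_vertex /=.
by congr (val (base_map m _)); apply: val_inj.
Qed.

Definition dual_hom : cosheaf_hom (dual_obj C) (dual_obj D) :=
  @CosheafHom (dual_obj C) (dual_obj D) (cosection_map m) dual_component
    dual_component_natural.

End DualMap.

Record relation := Relation {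
  left_type : Type;
  right_type : Type;
  related : set (left_type * right_type)
}.

Record relation_hom (R R' : relation) := RelationHom {
  left_fun : left_type R -> left_type R';
  right_fun : right_type R -> right_type R';
  relation_homP : forall x y, related (x, y) ->
    related (left_fun x, right_fun y)
}.

Definition relation_id (R : relation) : relation_hom R R :=
  @RelationHom R R id id (fun _ _ xy => xy).

Definition relation_comp (R S T : relation) (n : relation_hom S T)
    (m : relation_hom R S) : relation_hom R T :=
  @RelationHom R T (left_fun n \o left_fun m) (right_fun n \o right_fun m)
    (fun _ _ xy => relation_homP n (relation_homP m xy)).

Lemma relation_comp_idl R S (m : relation_hom R S) :
  relation_comp (relation_id S) m = m.
Proof. by case: m. Qed.

Lemma relation_comp_idr R S (m : relation_hom R S) :
  relation_comp m (relation_id R) = m.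
Proof. by case: m. Qed.

Lemma relation_comp_assoc Q R S T (h : relation_hom S T) (g : relation_hom R S)
    (f : relation_hom Q R) :
  relation_comp h (relation_comp g f) = relation_comp (relation_comp h g) f.
Proof. by []. Qed.

Definition Rel : category := {|
  obj := relation;
  hom := relation_hom;
  idm := relation_id;
  comp := relation_comp;
  comp_idl := relation_comp_idl;
  comp_idr := relation_comp_idr;
  comp_assoc := relation_comp_assoc
|}.

Definition transpose X Y (R : set (X * Y)) : set (Y * X) :=
  [set p | R (p.2, p.1)].

Definition transp_obj (R : relation) : relation :=
  Relation (transpose (@related R)).

Definition transp_hom (R S : relation) (m : relation_hom R S) :
    relation_hom (transp_obj R) (transp_obj S) :=
  @RelationHom (transp_obj R) (transp_obj S) (right_fun m) (left_fun m)
    (fun y x => @relation_homP R S m x y).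

Lemma transp_is_functor : @is_functor Rel Rel transp_obj transp_hom.
Proof. by []. Qed.

Definition Transp : functor Rel Rel := Functor transp_is_functor.

Section Dowker.
Variables (X Y : Type).

(* [A] and [B] are sets inside the carrier types, so that the Dowker complex of
   a restricted relation still lives on the carrier of the whole relation. *)
Definition dowker_simplices (A : set X) (B : set Y) (R : set (X * Y)) :
    set (set X) :=
  [set s | [/\ finite_set s, s !=set0, s `<=` A &
     exists2 y, B y & forall x, s x -> R (x, y)]].

Lemma dowker_finite A B R s : dowker_simplices A B R s -> finite_set s.
Proof. by case. Qed.

Lemma dowker_nonempty A B R s : dowker_simplices A B R s -> s !=set0.
Proof. by case. Qed.

Lemma dowker_sub A B R s t : dowker_simplices A B R t ->
  s `<=` t -> s !=set0 -> dowker_simplices A B R s.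
Proof.
move=> [tf _ tA [y By ty]] st s0; split=> //.
- exact: sub_finite_set tf.
- exact: subset_trans tA.
- by exists y => // x /st; apply: ty.
Qed.

Definition dowker (A : set X) (B : set Y) (R : set (X * Y)) : asc X :=
  Asc (@dowker_finite A B R) (@dowker_nonempty A B R) (@dowker_sub A B R).

Definition witnesses (R : set (X * Y)) (s : set X) : set Y :=
  [set y | forall x, s x -> R (x, y)].

Definition restrict (R : set (X * Y)) (A : set X) (B : set Y) : set (X * Y) :=
  R `&` (A `*` B).

End Dowker.

Section CoShvRep.
Variable R : relation.

Definition rep_base : asc (left_type R) := dowker setT setT (@related R).

Definition rep_costalk (s : simplices rep_base) : asc (right_type R) :=
  let Ys := witnesses (@related R) (val s) in
  dowker Ys (val s) (transpose (restrict (@related R) (val s) Ys)).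

Lemma rep_costalkE (s : simplices rep_base) t :
  rep_costalk s t <->
  [/\ finite_set t, t !=set0 & t `<=` witnesses (@related R) (val s)].
Proof.
split=> [[]//|[tf t0 ts]]; split=> //.
have [x sx] := simplex_nonempty (set_valP s).
exists x => // y ty; split=> //=; first exact: ts ty _ sx.
by split=> //; apply: ts.
Qed.

Lemma rep_costalk_mono (s t : simplices rep_base) :
  val s `<=` val t -> rep_costalk t `<=` rep_costalk s.
Proof.
move=> st u /rep_costalkE [uf u0 ut]; apply/rep_costalkE; split=> //.
by move=> y /ut yt x /st; apply: yt.
Qed.

Definition rep_extension (s t : simplices rep_base) (st : val s `<=` val t) :
    smap (rep_costalk t) (rep_costalk s) := smap_incl (rep_costalk_mono st).

Lemma rep_extension_incl s t (st : val s `<=` val t)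
    (c : vertices (rep_costalk t)) : val (rep_extension st c) = val c.
Proof. by []. Qed.

Lemma rep_extension_id s (ss : val s `<=` val s) :
  rep_extension ss = smap_id (rep_costalk s).
Proof. exact: smap_ext. Qed.

Lemma rep_extension_comp s t u (st : val s `<=` val t) (tu : val t `<=` val u)
    (su : val s `<=` val u) :
  rep_extension su = smap_comp (rep_extension st) (rep_extension tu).
Proof. exact: smap_ext. Qed.

Definition rep_obj : cosheaf :=
  Cosheaf rep_extension_incl rep_extension_id rep_extension_comp.

End CoShvRep.

Section CoShvRepMap.
Variables (R R' : relation) (m : relation_hom R R').

Lemma rep_base_simplicial s : rep_base R s -> rep_base R' (left_fun m @` s).
Proof.
move=> [sf [x sx] _ [y _ sy]]; split=> //; first exact: finite_image.
  by exists (left_fun m x), x.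
exists (right_fun m y) => // _ [x' sx' <-].
exact/relation_homP/sy.
Qed.

Definition rep_base_map : smap (rep_base R) (rep_base R') :=
  smap_of rep_base_simplicial.

Lemma rep_component_simplicial (s : simplices (rep_base R)) t :
  rep_costalk s t ->
  rep_costalk (simplex_map rep_base_map s) (right_fun m @` t).
Proof.
move=> /rep_costalkE [tf [y ty] ts]; apply/rep_costalkE; split.
- exact: finite_image.
- by exists (right_fun m y), y.
- move=> _ [y' ty' <-] _ [x /= sx <-].
  exact/relation_homP/ts.
Qed.

Definition rep_component (s : simplices (rep_base R)) :
    smap (rep_costalk s) (rep_costalk (simplex_map rep_base_map s)) :=
  smap_of (@rep_component_simplicial s).

Lemma rep_component_natural (s t : simplices (base (rep_obj R)))
    (st : val s `<=` val t) :
  smap_comp (@extension (rep_obj R') _ _ (simplex_map_mono rep_base_map st))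
    (rep_component t) =
  smap_comp (rep_component s) (@extension (rep_obj R) _ _ st).
Proof. exact: smap_ext. Qed.

Definition rep_hom : cosheaf_hom (rep_obj R) (rep_obj R') :=
  @CosheafHom (rep_obj R) (rep_obj R') rep_base_map rep_component
    rep_component_natural.

End CoShvRepMap.

Lemma rep_is_functor : @is_functor Rel CoShvAsc rep_obj rep_hom.
Proof. by split=> [R|R S T n m]; apply: cosheaf_hom_ext. Qed.

Definition CoShvRep : functor Rel CoShvAsc := Functor rep_is_functor.

(* Main.v *)
(** Two copies of [y] in the costalks of [CoShvRep R] at [s] and [t] are
    identified in the space of cosections, because [y] is then a witness for
    [s `|` t], so that both copies are images of the copy of [y] in the costalk
    at [s `|` t].  Hence the cosections of [CoShvRep R] are the Dowker complex
    of the transpose of [R], and [t] belongs to the costalk at [s] iff every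
    element of [s] is related to every element of [t]: a condition symmetric in
    [s] and [t]. *)

Require Import Defs.
From mathcomp Require Import all_boot.
From mathcomp Require Import boolp classical_sets cardinality.
From Stdlib Require Import Relation_Operators.

Set Implicit Arguments.
Unset Strict Implicit.
Unset Printing Implicit Defensive.

Local Open Scope classical_set_scope.

(** * Labels and representatives of cosection vertices *)

Section CosectionVertices.
Variable C : cosheaf.

Definition label (p : costalk_vertex C) : stalk_type C := val (projT2 p).

(** Extensions are inclusions, so each generating step of the relation preserves the underlying
    element. *)
Lemma same_cosection_label (p q : costalk_vertex C) :
  same_cosection p q -> label p = label q.
Proof.
elim=> {p q} [p q [a [b [ab [c [-> ->]]]]]|//|p q _ ->//|p q r _ -> _ ->//].
by rewrite /label /= extension_incl.
Qed.

Lemma class_label (p q : costalk_vertex C) :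
  class p = class q -> label p = label q.
Proof.
move=> pq; apply: same_cosection_label.
have : class q q by exact: rst_refl.
by rewrite -pq.
Qed.

Lemma cosection_vertexP (v : vertices (cosections C)) :
  {p : costalk_vertex C | v = class_of p}.
Proof.
apply: cid; have [a [s [as_ sE]]] := set_valP v.
have : class_image a s (val v) by rewrite -sE.
by move=> [c _ cE]; exists (existT _ a c); apply: val_inj.
Qed.

Definition representative (v : vertices (cosections C)) : costalk_vertex C :=
  sval (cosection_vertexP v).

Lemma representativeK (v : vertices (cosections C)) :
  class_of (representative v) = v.
Proof. by rewrite /representative; case: cosection_vertexP. Qed.

Lemma label_representative (p : costalk_vertex C) :
  label (representative (class_of p)) = label p.
Proof. exact/class_label/(congr1 val (representativeK (class_of p))). Qed.

End CosectionVertices.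

(** On base maps, the two sides send a class to classes of elements differing only by the cast in
    [cosheaf_id] or [cosheaf_comp]. That cast is an extension, so [class_extension] removes it.
    Components are restrictions of base maps and agree up to membership proofs. *)
Lemma dual_is_functor : @is_functor CoShvAsc CoShvAsc dual_obj dual_hom.
Proof.
split=> [C|C D E n m].
  apply: cosheaf_hom_ext => [v|//] /=.
  rewrite -(representativeK v) /= class_mapE; case: representative => a c.
  by rewrite class_extension.
apply: cosheaf_hom_ext => [v|S v] /=.
  rewrite -(representativeK v) /= !class_mapE; case: representative => a c.
  by rewrite class_extension.
by rewrite /dual_vertex /=; congr (val (base_map n _)); apply: val_inj => /=;
  congr (val (base_map m _)); apply: val_inj.
Qed.

(** * Cosections of [CoShvRep R] and the Dowker complex of the transpose *)

Lemma rep_base_set1 (R : relation) x y :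
  related (x, y) -> rep_base R [set x].
Proof.
move=> xy; split=> //; first by exists x.
by exists y => // _ ->.
Qed.

Section RepCosections.
Variable R : relation.

Let C := rep_obj R.
Let T := rep_obj (transp_obj R).

Lemma rep_costalk_vertexP (s : simplices (rep_base R)) (y : right_type R) :
  (y \in vertices (rep_costalk s)) <-> witnesses (@related R) (val s) y.
Proof.
split=> [/set_mem/rep_costalkE[_ _]|ys]; first exact.
apply/mem_set/rep_costalkE; split; first exact: finite_set1.
  by exists y.
by move=> _ ->.
Qed.

Lemma same_cosection_rep (p q : costalk_vertex C) :
  label p = label q -> same_cosection p q.
Proof.
case: p q => [s y] [t z] yz; have {}yz : val y = val z := yz.
have ys : witnesses (@related R) (val s) (val y).
  exact/rep_costalk_vertexP/(valP y).
have yt : witnesses (@related R) (val t) (val y).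
  by rewrite yz; apply/rep_costalk_vertexP/(valP z).
have [x sx] := simplex_nonempty (set_valP s).
have ust : rep_base R (val s `|` val t).
  split=> //.
  - rewrite finite_setU; split; apply: simplex_finite; exact: set_valP.
  - by exists x; left.
  - by exists (val y) => // u [/ys|/yt].
pose u : simplices (rep_base R) := SigSub (mem_set ust).
have yu : val y \in vertices (rep_costalk u).
  by apply/rep_costalk_vertexP => w /= [/ys|/yt].
have su : val s `<=` val u by left.
have tu : val t `<=` val u by right.
apply: (@rst_trans _ _ _ (existT _ u (SigSub yu))).
  apply/rst_sym/rst_step; exists s, u, su, (SigSub yu); split=> //.
  by congr existT; apply: val_inj.
apply: rst_step; exists t, u, tu, (SigSub yu); split=> //.
by congr existT; apply: val_inj.
Qed.

Lemma class_rep (p q : costalk_vertex C) :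
  label p = label q -> class p = class q.
Proof. by move=> /same_cosection_rep/class_eq. Qed.

Lemma transp_vertex (p : costalk_vertex C) :
  label p \in vertices (rep_base (transp_obj R)).
Proof.
case: p => s y; have ys := (rep_costalk_vertexP _ _).1 (valP y).
have [x sx] := simplex_nonempty (set_valP s).
exact/mem_set/(@rep_base_set1 (transp_obj R) _ x)/ys.
Qed.

(** This identifies a class with its single element [y]; labels are constant on classes, so the
    chosen representative is immaterial. *)
Definition transp_label (v : vertices (cosections C)) :
    vertices (rep_base (transp_obj R)) :=
  SigSub (transp_vertex (representative v)).

Lemma val_transp_label (p : costalk_vertex C) :
  val (transp_label (class_of p)) = label p.
Proof. exact: (@label_representative C). Qed.

Lemma transp_label_image (s : simplices (rep_base R)) t : rep_costalk s t ->
  vertex_image transp_label (@class_image C s t) = t.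
Proof.
move=> st; apply/seteqP; split.
  move=> _ [v [c tc cE] <-].
  have -> : v = class_of (existT _ s c : costalk_vertex C) by apply: val_inj.
  by rewrite val_transp_label.
move=> y ty; pose c : vertices (rep_costalk s) :=
  SigSub (mem_set (vertex_of_simplex st ty)).
exists (class_of (existT _ s c : costalk_vertex C)); last first.
  by rewrite val_transp_label.
by exists c.
Qed.

Lemma transp_label_simplicial S :
  cosections C S -> rep_base (transp_obj R) (vertex_image transp_label S).
Proof.
move=> [s [t [st ->]]]; rewrite transp_label_image //.
have /rep_costalkE [tf t0 ts] := st.
have [x sx] := simplex_nonempty (set_valP s).
(* Any element of [s] is related to all of [t], hence is a common witness for [t] in the
   transpose. *)
by split=> //; exists x => // y /ts; apply.
Qed.

Definition eta_base : smap (cosections C) (rep_base (transp_obj R)) :=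
  Smap transp_label_simplicial.

Lemma in_costalk_rep (S : simplices (cosections C))
    (s : simplices (rep_base R)) :
  in_costalk S s <->
  val (simplex_map eta_base S) `<=` witnesses (@related R) (val s).
Proof.
split=> [[t [st SE]]|Ss].
  by rewrite /= SE transp_label_image //; case/rep_costalkE: st.
have [a [t [at_ SE]]] := set_valP S.
rewrite /= SE transp_label_image // in Ss.
have /rep_costalkE [tf t0 ta] := at_.
(* The labels [t] of [S], taken from the costalk at [a], also form a simplex at [s]; by [class_rep]
   the copies at [a] and at [s] have the same classes. *)
exists t; split; first exact/rep_costalkE.
rewrite SE; apply/seteqP; split=> _ [c tc <-].
  have cs := (rep_costalk_vertexP s _).2 (Ss _ tc).
  by exists (SigSub cs) => //; apply: class_rep.
have ca := (rep_costalk_vertexP a _).2 (ta _ tc).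
by exists (SigSub ca) => //; apply: class_rep.
Qed.

Lemma dual_costalk_rep (S : simplices (cosections C)) :
  dual_costalk S = rep_costalk (simplex_map eta_base S).
Proof.
apply: asc_ext => s; split.
  move=> [a /in_costalk_rep Sa <-]; apply/rep_costalkE; split.
  - exact: simplex_finite (set_valP a).
  - exact: simplex_nonempty (set_valP a).
  - by move=> x ax y /Sa; apply.
move=> /rep_costalkE [sf s0 Ss].
have [y Sy] := simplex_nonempty (set_valP (simplex_map eta_base S)).
(* A vertex [y] of the image of [S] is related to all of [s], which makes [s] a simplex of the
   base. *)
have bs : rep_base R s by split=> //; exists y => // x /Ss; apply.
exists (SigSub (mem_set bs)) => //; apply/in_costalk_rep => z Sz x /Ss.
exact.
Qed.

(** Taking components to be inclusions, instead of transports along the equality of costalks, makes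
    their vertex functions compute to the identity. *)
Lemma dual_costalk_sub_rep (S : simplices (cosections C)) :
  dual_costalk S `<=` rep_costalk (simplex_map eta_base S).
Proof. by rewrite dual_costalk_rep. Qed.

Lemma eta_natural (S S' : simplices (base (dual_obj C)))
    (SS : val S `<=` val S') :
  smap_comp (@extension T _ _ (simplex_map_mono eta_base SS))
    (smap_incl (@dual_costalk_sub_rep S')) =
  smap_comp (smap_incl (@dual_costalk_sub_rep S))
    (@extension (dual_obj C) _ _ SS).
Proof. exact: smap_ext. Qed.

Definition eta_hom : cosheaf_hom (dual_obj C) T :=
  @CosheafHom (dual_obj C) T eta_base _ eta_natural.

(** * The inverse morphism *)

Lemma transp_vertexP (y : vertices (rep_base (transp_obj R))) :
  {p : costalk_vertex C | label p = val y}.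
Proof.
apply: cid; have [_ _ _ [x _ xy]] := set_valP y.
have {}xy : related (x, val y) := xy _ erefl.
(* Some [x] is related to [y], so a copy of [y] lies in the costalk at the singleton of [x]. *)
pose s : simplices (rep_base R) := SigSub (mem_set (rep_base_set1 xy)).
have ys : val y \in vertices (rep_costalk s).
  by apply/rep_costalk_vertexP => _ ->.
by exists (existT _ s (SigSub ys)).
Qed.

Definition transp_class (y : vertices (rep_base (transp_obj R))) :
    vertices (cosections C) :=
  class_of (sval (transp_vertexP y)).

Lemma transp_classK : cancel transp_class transp_label.
Proof.
move=> y; apply: val_inj; rewrite val_transp_label.
exact: svalP (transp_vertexP y).
Qed.

Lemma transp_labelK : cancel transp_label transp_class.
Proof.
move=> v; rewrite -[RHS]representativeK; apply/val_inj/class_rep.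
exact: svalP (transp_vertexP _).
Qed.

Lemma transp_class_simplicial t :
  rep_base (transp_obj R) t -> cosections C (vertex_image transp_class t).
Proof.
move=> bt; have [tf t0 _ [x _ xt]] := bt; have [y ty] := t0.
have xy : related (x, y) := xt _ ty.
(* With [x] a common witness for [t], all of [t] is a simplex of the costalk at the singleton of
   [x]. *)
pose s : simplices (rep_base R) := SigSub (mem_set (rep_base_set1 xy)).
have st : rep_costalk s t.
  by apply/rep_costalkE; split=> // z tz _ ->; apply: xt.
exists s, t; split=> //; apply/seteqP; split=> [_ [z tz <-]|_ [c tc <-]].
  exists (SigSub (mem_set (vertex_of_simplex st tz))) => //.
  exact/class_rep/esym/(svalP (transp_vertexP z)).
exists (SigSub (mem_set (vertex_of_simplex bt tc))) => //.
exact/class_rep/(svalP (transp_vertexP _)).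
Qed.

Definition eta_inv_base : smap (rep_base (transp_obj R)) (cosections C) :=
  Smap transp_class_simplicial.

Lemma eta_inv_baseK (t : simplices (rep_base (transp_obj R))) :
  simplex_map eta_base (simplex_map eta_inv_base t) = t.
Proof.
apply: val_inj; rewrite -simplex_map_comp -[RHS]simplex_map_id.
congr (val (simplex_map _ t)); apply: smap_ext => y.
exact: (congr1 val (transp_classK y)).
Qed.

Lemma rep_costalk_sub_dual (t : simplices (rep_base (transp_obj R))) :
  rep_costalk t `<=` dual_costalk (simplex_map eta_inv_base t).
Proof. by rewrite dual_costalk_rep eta_inv_baseK. Qed.

Lemma eta_inv_natural (t u : simplices (base T)) (tu : val t `<=` val u) :
  smap_comp (@extension (dual_obj C) _ _ (simplex_map_mono eta_inv_base tu))
    (smap_incl (@rep_costalk_sub_dual u)) =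
  smap_comp (smap_incl (@rep_costalk_sub_dual t)) (@extension T _ _ tu).
Proof. exact: smap_ext. Qed.

Definition eta_inv : cosheaf_hom T (dual_obj C) :=
  @CosheafHom T (dual_obj C) eta_inv_base _ eta_inv_natural.

Lemma eta_is_iso : @is_iso CoShvAsc _ _ eta_hom.
Proof.
(* Components hold by computation; only the base maps remain. *)
exists eta_inv; split; apply: cosheaf_hom_ext => //= v.
  exact: (congr1 val (transp_labelK v)).
exact: (congr1 val (transp_classK v)).
Qed.

End RepCosections.

Theorem theorem7 :
  exists dual_is_functor : @is_functor CoShvAsc CoShvAsc dual_obj dual_hom,
  let Dual : functor CoShvAsc CoShvAsc := Functor dual_is_functor in
  exists eta : forall R : Rel,
      hom (functor_comp Dual CoShvRep R) (functor_comp CoShvRep Transp R),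
    is_natural eta /\
    (forall R : Rel, is_iso (eta R)) /\
    (forall R : Rel,
      (forall (s : simplices (base (CoShvRep R))) (y : vertices (costalk s)),
        val (base_map (eta R) (class_of (existT _ s y))) = val y) /\
      (forall S : simplices (base (Dual (CoShvRep R))),
        costalk S =
          @costalk (CoShvRep (Transp R))
            (simplex_map (base_map (eta R)) S) /\
        (forall x : vertices (costalk S),
          val (component (eta R) S x) = val x))).
Proof.
exists dual_is_functor => Dual; exists eta_hom; split; last first.
  split=> [R|R]; first exact: eta_is_iso.
  split=> [s y|S]; first exact: val_transp_label.
  by split; first exact: dual_costalk_rep.
move=> R R' m; apply: cosheaf_hom_ext => [v|S x]; last by [].
rewrite -(representativeK v); set p := representative v.
(* This form exposes the induced map on a class; both sides then reduce to [right_fun m] applied to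
   the label of [p]. *)
transitivity (val (eta_base R' (cosection_map (rep_hom m) (class_of p)))) => //.
by rewrite cosection_map_class /= !label_representative.
Qed.
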